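(* Let $\Lambda\in\mathfrak L_\beta$, $\widetilde\Lambda=\Lambda+\mathbb Z^n$, and let $\varphi_\Lambda=\sum_{\gamma\in\widetilde\Lambda}x^{\gamma}r_{\Lambda,\gamma}(\log x)\in\mathscr F^{\log}_{\widetilde\Lambda}$. If $\varphi_\Lambda$ is annihilated by the Euler operators $(A\theta_x)_i-\beta_i$ for $i=1,\dots,d$, then $$\mathrm{Supp}(\varphi_\Lambda)\subset\widetilde\Lambda\cap\{\gamma\in\mathbb C^n\mid A\gamma=\beta\}=\Lambda.$$ In particular, $\varphi_\Lambda\in\mathscr F^{\log}_{\widetilde\Lambda}[\Lambda]$. Moreover, its coefficients satisfy $$(A\partial_y)_i\bullet r_{\Lambda,\gamma}=0\qquad(\gamma\in\Lambda,\ i=1,\dots,d).$$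
   Context: $A=(a_{ij})\in\mathrm{Mat}_{d\times n}(\mathbb Z)$ has rank $d$, $\beta\in\mathbb C^d$, $L=\mathrm{Ker}_{\mathbb Z}(A)$. An exponent lattice is a coset $\Lambda=\lambda+L$ with $\lambda\in\mathbb C^n$, $A\lambda=\beta$; $\mathfrak L_\beta$ is the set of all of them. $D=\mathbb C\langle x_1,\dots,x_n,\partial_{x_1},\dots,\partial_{x_n}\rangle$ is the Weyl algebra, $\theta_{x_j}=x_j\partial_{x_j}$, $(A\theta_x)_i=\sum_ja_{ij}\theta_{x_j}$. $S=\mathbb C[\partial_{y_1},\dots,\partial_{y_n}]$ acts on $\mathbb C[y]=\mathbb C[y_1,\dots,y_n]$ by differentiation, written $\bullet$, and $(A\partial_y)_i=\sum_ja_{ij}\partial_{y_j}$. $\mathscr F^{\log}_{\widetilde\Lambda}$ is the space of all formal (possibly infinite) sums $\sum_{\gamma\in\widetilde\Lambda}x^\gamma p_\gamma(\log x)$ with $p_\gamma\in\mathbb C[y]$, where the $x^\gamma$ are formal symbols and equality is coefficientwise. $D$ acts coefficientwise by $x_j\bullet(x^\gamma p(\log x))=x^{\gamma+e_j}p(\log x)$ and $\partial_{x_j}\bullet(x^\gamma p(\log x))=x^{\gamma-e_j}((\gamma_j+\partial_{y_j})\bullet p)(\log x)$, with $e_j$ the $j$-th standard basis vector. $\mathrm{Supp}(\varphi)=\{\gamma\in\widetilde\Lambda\mid p_\gamma\ne0\}$, and $\mathscr F^{\log}_{\widetilde\Lambda}[\Lambda]=\{\varphi\mid\mathrm{Supp}(\varphi)\subset\Lambda\}$.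 *)

(* Defs.v *)
From HB Require Import structures.
From mathcomp Require Import all_boot all_order all_algebra.
From mathcomp Require Import boolp classical_sets functions reals.
From mathcomp Require Import complex.
From mathcomp.multinomials Require Import mpoly.

Set Implicit Arguments.
Unset Strict Implicit.
Unset Printing Implicit Defensive.

Import GRing.Theory.

Local Open Scope classical_set_scope.
Local Open Scope ring_scope.

(* Throughout, the complex numbers are R[i] with R a realType. *)

Definition rankZ d n (A : 'M[int]_(d, n)) : nat :=
  \rank (map_mx (intr : int -> rat) A).

Definition complex_mx (R : realType) m n (A : 'M[int]_(m, n)) : 'M[R[i]]_(m, n) :=
  map_mx (intr : int -> R[i]) A.

Definition kerZ d n (A : 'M[int]_(d, n)) : set 'cV[int]_n :=
  [set u | A *m u = 0].

Definition exponent_lattices (R : realType) d n (A : 'M[int]_(d, n))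
    (beta : 'cV[R[i]]_d) : set (set 'cV[R[i]]_n) :=
  [set Lam | exists2 lam : 'cV[R[i]]_n, complex_mx R A *m lam = beta &
     Lam = [set lam + complex_mx R u | u in kerZ A]].

Definition addZn (R : realType) n (Lam : set 'cV[R[i]]_n) : set 'cV[R[i]]_n :=
  [set lam + complex_mx R z | lam in Lam & z in [set: 'cV[int]_n]].

Definition affine_fiber (R : realType) d n (A : 'M[int]_(d, n))
    (beta : 'cV[R[i]]_d) : set 'cV[R[i]]_n :=
  [set gam | complex_mx R A *m gam = beta].

(* An element q of S is a polynomial whose variable 'X_j stands for the partial
   derivative with respect to y_j; it acts on a polynomial p in y. *)
Definition Sact (R : realType) n (q p : {mpoly R[i][n]}) : {mpoly R[i][n]} :=
  \sum_(m <- msupp q) q@_m *: mderivm m p.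

Definition Adely (R : realType) d n (A : 'M[int]_(d, n)) (i : 'I_d) :
    {mpoly R[i][n]} :=
  \sum_(j < n) (A i j)%:~R *: 'X_j.

(* phi : log_series R n is the formal sum of the x^gam (phi gam)(log x), with
   gam ranging over all of C^n; the sums indexed by a subset of C^n are those
   supported in that subset, see Flog. *)
Definition log_series (R : realType) n := 'cV[R[i]]_n -> {mpoly R[i][n]}.
HB.instance Definition _ (R : realType) n :=
  GRing.Lmodule.copy (log_series R n) ('cV[R[i]]_n -> {mpoly R[i][n]}).

Definition Supp (R : realType) n (phi : log_series R n) : set 'cV[R[i]]_n :=
  [set gam | phi gam != 0].

Definition Flog (R : realType) n (Lt : set 'cV[R[i]]_n) : set (log_series R n) :=
  [set phi | Supp phi `<=` Lt].

Definition Flog_sub (R : realType) n (Lt Lam : set 'cV[R[i]]_n) :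
    set (log_series R n) :=
  [set phi | Flog Lt phi /\ Supp phi `<=` Lam].

Definition log_term (R : realType) n (gam : 'cV[R[i]]_n) (p : {mpoly R[i][n]}) :
    log_series R n :=
  fun gam' => if gam' == gam then p else 0.

Definition e_ (R : realType) n (j : 'I_n) : 'cV[R[i]]_n := delta_mx j 0.
Arguments e_ {R n} j.

(* The actions of the generators of the Weyl algebra, given by the coefficient
   at gam of the result; lemmas xact_term and dact_term give them on a single
   term. *)
Definition xact (R : realType) n (j : 'I_n) (phi : log_series R n) :
    log_series R n :=
  fun gam => phi (gam - e_ j).

Definition dact (R : realType) n (j : 'I_n) (phi : log_series R n) :
    log_series R n :=
  fun gam => Sact (((gam + e_ j) j 0)%:MP + 'X_j) (phi (gam + e_ j)).

Definition theta (R : realType) n (j : 'I_n) (phi : log_series R n) :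
    log_series R n :=
  xact j (dact j phi).

Definition euler (R : realType) d n (A : 'M[int]_(d, n)) (beta : 'cV[R[i]]_d)
    (i : 'I_d) (phi : log_series R n) : log_series R n :=
  (\sum_(j < n) (A i j)%:~R *: theta j phi) - beta i 0 *: phi.

Lemma xact_term (R : realType) n (j : 'I_n) (gam : 'cV[R[i]]_n) p :
  xact j (log_term gam p) = log_term (gam + e_ j) p.
Proof. by apply/funext => g; rewrite /xact /log_term subr_eq. Qed.

Lemma dact_term (R : realType) n (j : 'I_n) (gam : 'cV[R[i]]_n) p :
  dact j (log_term gam p) =
  log_term (gam - e_ j) (Sact ((gam j 0)%:MP + 'X_j) p).
Proof.
apply/funext => g; rewrite /dact /log_term [g == _ - _]eq_sym subr_eq eq_sym.
case: eqP => [->//|_]; rewrite /Sact big1 // => m _.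
by rewrite linear0 scaler0.
Qed.

(* Main.v *)
Require Import Defs.
From mathcomp Require Import all_boot all_order all_algebra.
From mathcomp Require Import boolp classical_sets functions reals.
From mathcomp Require Import complex.
From mathcomp.multinomials Require Import ssrcomplements mpoly.

(** The Euler operators move no exponent: on [x^gam p(log x)] the [i]-th one
acts as [x^gam ((A gam - beta)_i + (A d_y)_i . p)(log x)] (lemma [eulerE]), so
that annihilation of [phi] is a condition on each coefficient separately.  There
[(A d_y)_i] is a derivation with constant coefficients, which strictly lowers
degree, hence has no nonzero eigenvalue on polynomials: in [c p + D p = 0] with
[p != 0], the top monomial of [p] survives only in [c p], and so [c = 0] (lemma
[const_derivation_eigenvalue0]).  Therefore a nonzero coefficient at [gam]
forces [A gam = beta], and then what is left of the equation is
[(A d_y)_i . p = 0].  That the shifts of [Lam] by integer vectors which lie on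
the fiber over [beta] are those of [Lam] itself is linear algebra: an integer
vector killed by [A] over the complex numbers is killed by [A] over the
integers, the integers being embedded there. *)

Import Order.TTheory GRing.Theory Num.Theory.

Local Open Scope classical_set_scope.
Local Open Scope ring_scope.

(** Summing over all monomials of bounded degree in place of the support of [q]
gives index sets common to several operators, whence linearity in [q]. *)
Lemma SactwE (R : realType) (n k : nat) (q p : {mpoly R[i][n]}) :
  (msize q <= k)%N ->
  Sact q p = \sum_(m : 'X_{1..n < k}) q@_m *: mderivm m p.
Proof.
move=> le_qk; pose I : subFinType _ := 'X_{1..n < k}.
rewrite /Sact (big_mksub I) ?msupp_uniq //=; last first.
  by move=> m /msize_mdeg_lt/leq_trans; apply.
by rewrite big_rmcond //= => m /memN_msupp_eq0 ->; rewrite scale0r.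
Qed.

Lemma Sact_linearl (R : realType) (n : nat) (p : {mpoly R[i][n]}) :
  linear (fun q => Sact q p).
Proof.
move=> c q1 q2 /=.
pose k := maxn (msize (c *: q1 + q2)) (maxn (msize q1) (msize q2)).
rewrite !(@SactwE R n k) ?leq_max ?leqnn ?orbT //.
rewrite scaler_sumr -big_split /=; apply: eq_bigr => m _.
by rewrite mcoeffD mcoeffZ scalerDl scalerA.
Qed.

Lemma Sact0 (R : realType) (n : nat) (p : {mpoly R[i][n]}) : Sact 0 p = 0.
Proof. by rewrite /Sact msupp0 big_nil. Qed.

Lemma SactD (R : realType) (n : nat) (q1 q2 p : {mpoly R[i][n]}) :
  Sact (q1 + q2) p = Sact q1 p + Sact q2 p.
Proof. by have := Sact_linearl _ _ p 1 q1 q2; rewrite /= !scale1r. Qed.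

Lemma SactZ (R : realType) (n : nat) (c : R[i]) (q p : {mpoly R[i][n]}) :
  Sact (c *: q) p = c *: Sact q p.
Proof. by have := Sact_linearl _ _ p c q 0; rewrite /= Sact0 !addr0. Qed.

Lemma SactC (R : realType) (n : nat) (c : R[i]) (p : {mpoly R[i][n]}) :
  Sact c%:MP p = c *: p.
Proof.
rewrite /Sact msuppC; case: eqP => [->|_]; first by rewrite big_nil scale0r.
by rewrite big_seq1 mcoeffC eqxx mulr1 mderivm0m.
Qed.

Lemma SactX (R : realType) (n : nat) (j : 'I_n) (p : {mpoly R[i][n]}) :
  Sact 'X_j p = mderiv j p.
Proof. by rewrite /Sact msuppX big_seq1 mcoeffX eqxx scale1r mderivmU1m. Qed.

Lemma Sact_Adely (R : realType) (d n : nat) (A : 'M[int]_(d, n)) (i : 'I_d)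
    (p : {mpoly R[i][n]}) :
  Sact (Adely R A i) p = \sum_(j < n) (A i j)%:~R *: mderiv j p.
Proof.
rewrite /Adely (big_morph (fun q => Sact q p) (id1 := 0) (op1 := +%R)).
- by apply: eq_bigr => j _; rewrite SactZ SactX.
- by move=> q1 q2; rewrite SactD.
- exact: Sact0.
Qed.

(** Derivatives lower degree, so the leading monomial of [p] does not occur in
[sum_j v_j d_j p], and its coefficient in the vanishing sum is [c] times the
leading coefficient of [p]. *)
Lemma const_derivation_eigenvalue0 (K : idomainType) (n : nat) (c : K)
    (v : 'I_n -> K) (p : {mpoly K[n]}) :
  c *: p + \sum_(j < n) v j *: mderiv j p = 0 -> p != 0 -> c = 0.
Proof.
move=> eq0 p_neq0; have /(congr1 (mcoeff (mlead p))) := eq0.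
rewrite mcoeffD mcoeffZ mcoeff0 raddf_sum /= big1 ?addr0 => [|j _]; last first.
  rewrite mcoeffZ mcoeff_deriv mcoeff_gt_mlead ?mul0rn ?mulr0 //.
  by rewrite lt_mdeg_ltmc // mdegD mdeg1 addn1.
by move/eqP; rewrite mulf_eq0 mleadc_eq0 (negPf p_neq0) orbF => /eqP.
Qed.

Lemma thetaE (R : realType) (n : nat) (j : 'I_n) (phi : log_series R n)
    (gam : 'cV[R[i]]_n) :
  theta j phi gam = gam j 0 *: phi gam + mderiv j (phi gam).
Proof.
by rewrite /theta /xact /dact subrK SactD SactC SactX.
Qed.

Lemma eulerE (R : realType) (d n : nat) (A : 'M[int]_(d, n))
    (beta : 'cV[R[i]]_d) (i : 'I_d) (phi : log_series R n)
    (gam : 'cV[R[i]]_n) :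
  euler A beta i phi gam =
  (complex_mx R A *m gam - beta) i 0 *: phi gam +
  Sact (Adely R A i) (phi gam).
Proof.
have -> : euler A beta i phi gam =
    \sum_(j < n) (A i j)%:~R *: theta j phi gam - beta i 0 *: phi gam.
  rewrite /euler; congr (_ - _).
  exact: (big_morph (fun psi : log_series R n => psi gam)).
rewrite Sact_Adely !mxE scalerBl addrAC scaler_suml -big_split /=.
congr (_ - _); apply: eq_bigr => j _.
by rewrite thetaE scalerDr scalerA mxE.
Qed.

Lemma complex_mx_inj (R : realType) (m n : nat) :
  injective (@complex_mx R m n).
Proof.
move=> A B eqAB; apply/matrixP => i j.
by have /matrixP/(_ i j) := eqAB; rewrite !mxE; apply: intr_inj.
Qed.

Lemma complex_mxM (R : realType) (m n p : nat) (A : 'M[int]_(m, n))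
    (B : 'M[int]_(n, p)) :
  complex_mx R (A *m B) = complex_mx R A *m complex_mx R B.
Proof. exact: map_mxM. Qed.

Lemma mul_complex_mx_eq0 (R : realType) (d n : nat) (A : 'M[int]_(d, n))
    (u : 'cV[int]_n) :
  complex_mx R A *m complex_mx R u = 0 <-> kerZ A u.
Proof.
rewrite /kerZ /= -complex_mxM; split=> [Au0|->]; last exact: map_mx0.
by apply: (@complex_mx_inj R); rewrite Au0 /complex_mx map_mx0.
Qed.

Lemma exponent_lattice_fiber (R : realType) (d n : nat) (A : 'M[int]_(d, n))
    (beta : 'cV[R[i]]_d) (Lam : set 'cV[R[i]]_n) :
  exponent_lattices A beta Lam -> addZn Lam `&` affine_fiber A beta = Lam.
Proof.
case=> lam Alam ->; apply/seteqP; split=> gam /=.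
  case=> -[_ [u Au <-] [z _ <-]]; rewrite /affine_fiber /= !mulmxDr Alam.
  move/mul_complex_mx_eq0: (Au) => ->; rewrite addr0 => /(canRL (addKr _)).
  rewrite addNr => /mul_complex_mx_eq0 Az; exists (u + z).
    by rewrite /kerZ /= mulmxDr Au Az addr0.
  by rewrite /complex_mx map_mxD addrA.
case=> u Au <-; split.
  exists (lam + complex_mx R u); first by exists u.
  by exists 0 => //; rewrite /complex_mx map_mx0 addr0.
by rewrite /affine_fiber /= mulmxDr Alam; move/mul_complex_mx_eq0: Au => ->;
  rewrite addr0.
Qed.

Theorem proposition3p1 (R : realType) (d n : nat) (A : 'M[int]_(d, n))
    (beta : 'cV[R[i]]_d) (Lam : set 'cV[R[i]]_n) (phi : log_series R n) :
  rankZ A = d ->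
  exponent_lattices A beta Lam ->
  Flog (addZn Lam) phi ->
  (forall i : 'I_d, euler A beta i phi = 0) ->
  [/\ Supp phi `<=` addZn Lam `&` affine_fiber A beta,
      addZn Lam `&` affine_fiber A beta = Lam,
      Flog_sub (addZn Lam) Lam phi &
      forall gam : 'cV[R[i]]_n, Lam gam ->
        forall i : 'I_d, Sact (Adely R A i) (phi gam) = 0].
Proof.
move=> _ exponent_Lam Flog_phi euler_phi0.
have fiber_Lam := exponent_lattice_fiber _ _ _ _ _ _ exponent_Lam.
have coeff_eq0 i gam : (complex_mx R A *m gam - beta) i 0 *: phi gam +
    Sact (Adely R A i) (phi gam) = 0.
  by rewrite -eulerE euler_phi0.
have Supp_phi : Supp phi `<=` addZn Lam `&` affine_fiber A beta.
  move=> gam gam_supp; split; first exact: Flog_phi.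
  apply/subr0_eq/colP => i; rewrite [RHS]mxE.
  move: (coeff_eq0 i gam); rewrite Sact_Adely.
  by move/const_derivation_eigenvalue0; apply.
split=> //; first by split=> //; rewrite -[X in _ `<=` X]fiber_Lam.
move=> gam; rewrite -fiber_Lam => -[_ Agam] i.
move: (coeff_eq0 i gam); rewrite (_ : _ *m _ = beta) //.
by rewrite subrr mxE scale0r add0r.
Qed.
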